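(* Let $G$ and $H$ be locally compact second countable groups. Then $G$ and $H$ are coarsely equivalent if and only if they admit a topological coupling.
   Context: Topological groups are Hausdorff, as usual. Coarse equivalence of metric spaces: a map $\phi\colon X\to Y$ between metric spaces is a coarse equivalence if (i) $\phi[X]$ is cobounded in $Y$, i.e. $\sup_{y\in Y} d(y,\phi[X])<\infty$, and (ii) for all sequences $(x_n)$, $(z_n)$ in $X$, $\lim_n d(x_n,z_n)=\infty$ if and only if $\lim_n d(\phi(x_n),\phi(z_n))=\infty$. The map $\phi$ is not required to be continuous. Coarse equivalence of groups: every locally compact second countable group $G$ admits a left-invariant metric that is compatible (induces the topology of $G$) and proper (its closed balls are compact), and the identity map is a coarse equivalence between any two such metrics on $G$. Two locally compact second countable groups $G$ and $H$ are coarsely equivalent if there is a coarse equivalence $(H,d_H)\to(G,d_G)$, where $d_G$ and $d_H$ are compatible left-invariant proper metrics on $G$ and $H$; this does not depend on the choice of $d_G$ and $d_H$. Topological coupling: a topological coupling of locally compact groups $G$ and $H$ is a pair $G\curvearrowright X\curvearrowleft H$ consisting of a left action of $G$ and a right action of $H$ on a nonempty locally compact Hausdorff space $X$ that commute, i.e. $(g\cdot x)\cdot h=g\cdot(x\cdot h)$, and such that both actions are: - continuous: the maps $G\times X\to X$ and $X\times H\to X$ are jointly continuous; - proper: for every compact $K\subseteq X$, the sets $\{g\in G\mid gK\cap K\neq\emptyset\}$ and $\{h\in H\mid Kh\cap K\neq\emptyset\}$ are compact; - cocompact: there is a compact $K\subseteq X$ with $X=G\cdot K=K\cdot H$. *)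

(* Defs.v *)
From HB Require Import structures.
From mathcomp Require Import all_boot all_order all_algebra.
From mathcomp Require Import all_classical all_reals all_analysis.

Set Implicit Arguments.
Unset Strict Implicit.
Unset Printing Implicit Defensive.

Import Order.TTheory GRing.Theory Num.Theory.
Import numFieldTopology.Exports.

Local Open Scope classical_set_scope.
Local Open Scope ring_scope.

(* [hausdorff_space] is not part of the structure. *)
HB.mixin Record isTopologicalGroup G of Topological G & Group G := {
  mulg_continuous : continuous (fun p : G * G => (p.1 * p.2)%g) ;
  invg_continuous : continuous (fun g : G => (g^-1)%g)
}.

#[short(type="topologicalGroupType")]
HB.structure Definition TopologicalGroup :=
  {G of Topological G & Group G & isTopologicalGroup G}.

Section Metrics.
Context {R : realType}.

(* [metricType R] ties the metric to a topology on the carrier; here one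
   topological group carries several metrics, so they are plain functions. *)
Record is_metric (T : Type) (d : T -> T -> R) : Prop := IsMetric {
  is_metric_refl : forall x, d x x = 0 ;
  is_metric_eq : forall x y, d x y = 0 -> x = y ;
  is_metric_sym : forall x y, d x y = d y x ;
  is_metric_triangle : forall x y z, d x z <= d x y + d y z
}.

Definition compatible_metric (T : topologicalType) (d : T -> T -> R) : Prop :=
  forall x : T, nbhs x = nbhs_ball_ (fun y (e : R) => [set z | d y z < e]) x.

Definition proper_metric (T : topologicalType) (d : T -> T -> R) : Prop :=
  forall (x : T) (r : R), compact [set y | d x y <= r].

Definition left_invariant (G : groupType) (d : G -> G -> R) : Prop :=
  forall g x y : G, d (g * x)%g (g * y)%g = d x y.

(* Infimum in the extended reals, so that the distance to [set0] is [+oo]. *)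
Definition dist_to_set (T : Type) (d : T -> T -> R) (y : T) (A : set T)
    : \bar R :=
  ereal_inf [set (d y a)%:E | a in A].

Definition cobounded (T : Type) (d : T -> T -> R) (A : set T) : Prop :=
  (ereal_sup [set dist_to_set d y A | y in [set: T]] < +oo)%E.

Record coarse_equivalence (X Y : Type) (dX : X -> X -> R) (dY : Y -> Y -> R)
    (phi : X -> Y) : Prop := CoarseEquivalence {
  coarse_equivalence_cobounded : cobounded dY (range phi) ;
  coarse_equivalence_seq : forall x z : nat -> X,
    (dX (x n) (z n) @[n --> \oo] --> +oo) <->
    (dY (phi (x n)) (phi (z n)) @[n --> \oo] --> +oo)
}.

Record admissible_metric (G : topologicalGroupType) (d : G -> G -> R) : Prop :=
  AdmissibleMetric {
  admissible_is_metric : is_metric d ;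
  admissible_compatible : compatible_metric d ;
  admissible_left_invariant : left_invariant d ;
  admissible_proper : proper_metric d
}.

End Metrics.

(* On locally compact second countable Hausdorff groups admissible metrics exist,
   and the choice of [dG] and [dH] is immaterial. *)
Definition coarsely_equivalent (R : realType) (G H : topologicalGroupType)
    : Prop :=
  exists (dG : G -> G -> R) (dH : H -> H -> R),
    [/\ admissible_metric dG, admissible_metric dH &
        exists phi : H -> G, coarse_equivalence dH dG phi].

Section Couplings.
Context (G H : topologicalGroupType) (X : topologicalType).

Record is_left_action (l : G -> X -> X) : Prop := IsLeftAction {
  left_action1 : forall x, l 1%g x = x ;
  left_actionM : forall g g' x, l (g * g')%g x = l g (l g' x)
}.

Record is_right_action (r : X -> H -> X) : Prop := IsRightAction {
  right_action1 : forall x, r x 1%g = x ;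
  right_actionM : forall h h' x, r x (h * h')%g = r (r x h) h'
}.

Record is_topological_coupling (l : G -> X -> X) (r : X -> H -> X) : Prop :=
  IsTopologicalCoupling {
  coupling_nonempty : [set: X] !=set0 ;
  coupling_locally_compact : locally_compact [set: X] ;
  coupling_hausdorff : hausdorff_space X ;
  coupling_left : is_left_action l ;
  coupling_right : is_right_action r ;
  coupling_commute : forall g x h, r (l g x) h = l g (r x h) ;
  coupling_left_continuous : continuous (fun p : G * X => l p.1 p.2) ;
  coupling_right_continuous : continuous (fun p : X * H => r p.1 p.2) ;
  coupling_left_proper : forall K : set X, compact K ->
    compact [set g | (l g @` K) `&` K !=set0] ;
  coupling_right_proper : forall K : set X, compact K ->
    compact [set h | (r^~ h @` K) `&` K !=set0] ;
  coupling_cocompact : exists K : set X,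
    [/\ compact K,
        [set: X] = [set l g x | g in [set: G] & x in K] &
        [set: X] = [set r x h | x in K & h in [set: H]]]
}.

End Couplings.

Definition admit_topological_coupling (G H : topologicalGroupType) : Prop :=
  exists (X : topologicalType) (l : G -> X -> X) (r : X -> H -> X),
    is_topological_coupling l r.

(* Main.v *)
(* From a coarse equivalence phi : H -> G to a coupling: the distance to the
   graph of phi is a 1-Lipschitz function on H x G. The space X consists of all
   nonnegative 1-Lipschitz functions satisfying the same quantitative estimates,
   with pointwise convergence; G and H act by translation in the two variables.
   The functions of X with a given bound at (1, 1) form a compact set, by
   Tychonoff and because every estimate passes to pointwise limits, and proper
   cocompactness then follows from the estimates. No regularity of phi is needed,
   since the distance to its graph is automatically continuous.

   From a coupling to a coarse equivalence: choose phi h with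
   x0 h in (phi h) K, where G K = X = K H. The required proper left-invariant
   metrics are those of Birkhoff-Kakutani and Struble: take neighbourhoods U n of
   1, indexed by the integers, with U n ^ 3 inside U (n + 1), give the elements of
   U n weight at most about 2 ^ n, and minimize the total weight of a
   factorization. *)
Require Import Defs.
From mathcomp Require Import all_boot all_order all_algebra.
From mathcomp Require Import all_classical all_reals all_analysis.
From mathcomp Require Import lra zify.
Import Order.TTheory GRing.Theory Num.Theory.
Import numFieldTopology.Exports numFieldNormedType.Exports.

Set Implicit Arguments.
Unset Strict Implicit.
Unset Printing Implicit Defensive.

Local Open Scope classical_set_scope.
Local Open Scope ring_scope.

(** * Subadditive norms built from weights by summing along chains *)

Lemma split_sum_le (R : realDomainType) (T : Type) (f : T -> R) (s : seq T)
    (a b : R) :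
  (forall x, 0 <= f x) -> s <> [::] -> 0 <= a -> 0 <= b ->
  \sum_(x <- s) f x <= a + b ->
  exists s1 x s2, [/\ s = s1 ++ x :: s2,
    \sum_(x <- s1) f x <= a & \sum_(x <- s2) f x <= b].
Proof.
move=> f_ge0; elim: s a => // x s ih a _ a0 b0; rewrite big_cons => sab.
(* A head exceeding [a] is the cutting link; a smaller one joins the first block and uses up part of
   [a]. *)
have [xa|ax] := leP (f x) a; last first.
  exists [::], x, s; split => //; first by rewrite big_nil.
  by move: sab ax; lra.
have [s0|sN0] := pselect (s = [::]).
  by exists [::], x, [::]; rewrite s0 !big_nil.
have [||s1 [y [s2 [-> s1a s2b]]]] := ih (a - f x) sN0 _ b0; [lra|lra|].
by exists (x :: s1), y, s2; split => //; rewrite big_cons; lra.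
Qed.

Section chain_norm.
Context {R : realType} {G : groupType} (f : G -> R).
Hypothesis f_ge0 : forall g, 0 <= f g.
Hypothesis f1 : f 1%g = 0.
Hypothesis fV : forall g, f g^-1%g = f g.
Hypothesis fM3 : forall t a b c,
  f a <= t -> f b <= t -> f c <= t -> f (a * b * c)%g <= 2 * t.

Definition chain_lengths (g : G) : set R :=
  [set \sum_(x <- s) f x | s in [set s | (\prod_(x <- s) x)%g = g]].

(** With [f 1 = 0], this is the largest subadditive function below [f]; the empty chain is allowed
    for 1. *)
Definition chain_norm (g : G) : R := inf (chain_lengths g).

Lemma chain_lengths_ge0 g : lbound (chain_lengths g) 0.
Proof. by move=> _ [s _ <-]; apply: sumr_ge0. Qed.

Lemma chain_lengths_inf g : has_inf (chain_lengths g).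
Proof.
split; last by exists 0; exact: chain_lengths_ge0.
by exists (\sum_(x <- [:: g]) f x), [:: g] => //=; rewrite big_seq1.
Qed.

Lemma chain_norm_ge0 g : 0 <= chain_norm g.
Proof.
by apply: lb_le_inf (@chain_lengths_ge0 g); case: (chain_lengths_inf g).
Qed.

Lemma chain_norm_le s : chain_norm (\prod_(x <- s) x)%g <= \sum_(x <- s) f x.
Proof.
apply: ge_inf; last by exists s.
by case: (chain_lengths_inf (\prod_(x <- s) x)%g).
Qed.

Lemma chain_norm_le_weight g : chain_norm g <= f g.
Proof. by have := chain_norm_le [:: g]; rewrite !big_seq1. Qed.

Lemma le_chain_norm g t :
  (forall s, (\prod_(x <- s) x)%g = g -> t <= \sum_(x <- s) f x) ->
  t <= chain_norm g.
Proof.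
move=> tle; apply: lb_le_inf; first by case: (chain_lengths_inf g).
by move=> _ [s sg <-]; exact: tle.
Qed.

Lemma chain_norm1 : chain_norm 1%g = 0.
Proof.
by apply/le_anti; rewrite -{1}f1 chain_norm_le_weight chain_norm_ge0.
Qed.

Lemma chain_normM g h : chain_norm (g * h)%g <= chain_norm g + chain_norm h.
Proof.
rewrite -lerBlDr; apply: le_chain_norm => s sg.
rewrite lerBlDr -lerBlDl; apply: le_chain_norm => t th.
by rewrite lerBlDl -big_cat -sg -th -big_cat; exact: chain_norm_le.
Qed.

Lemma chain_normV g : chain_norm g^-1%g = chain_norm g.
Proof.
suff le_V h : chain_norm h^-1%g <= chain_norm h.
  by apply/le_anti; rewrite le_V -{1}(invgK g) le_V.
apply: le_chain_norm => s <-.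
have -> : \sum_(x <- s) f x = \sum_(x <- [seq x^-1%g | x <- rev s]) f x.
  rewrite big_map [RHS](perm_big s) ?perm_rev//=.
  by apply: eq_bigr => x _; rewrite fV.
rewrite -[in X in X <= _](revK s) -prodgV.
rewrite -(big_map (fun x => x^-1%g) xpredT id).
exact: chain_norm_le.
Qed.

(* Frink: cut the chain at the link where the running total passes half. *)
Lemma weight_prod s : f (\prod_(x <- s) x)%g <= 2 * \sum_(x <- s) f x.
Proof.
have [n] := ubnP (size s); elim: n s => // n ih s sn.
have [->|sN0] := pselect (s = [::]); first by rewrite !big_nil f1 mulr0.
set S := \sum_(x <- s) f x.
have S0 : 0 <= S by apply: sumr_ge0.
have [|||s1 [x [s2 [sE s1S s2S]]]] :=
  @split_sum_le _ _ f s (S / 2) (S / 2) f_ge0 sN0; [lra|lra|rewrite -/S; lra|].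
have szs : (size s1 < n /\ size s2 < n)%N.
  by move: sn; rewrite sE size_cat /=; split; lia.
have xS : f x <= S.
  rewrite /S sE big_cat big_cons /=.
  have := @sumr_ge0 R _ s1 xpredT f (fun i _ => f_ge0 i).
  have := @sumr_ge0 R _ s2 xpredT f (fun i _ => f_ge0 i).
  by lra.
have := ih s1 szs.1; have := ih s2 szs.2 => f2 f1'.
have := @fM3 S (\prod_(x <- s1) x)%g x (\prod_(x <- s2) x)%g.
by rewrite sE big_cat big_cons /= mulgA; apply => //; lra.
Qed.

(** Together with [chain_norm_le_weight], this puts norm and weight within a factor 2 of each other,
    so the norm inherits both the small and the large scales of the weight. *)
Lemma weight_le_chain_norm g : f g <= 2 * chain_norm g.
Proof.
rewrite -ler_pdivrMl//; apply: le_chain_norm => s <-.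
by rewrite ler_pdivrMl// weight_prod.
Qed.

End chain_norm.

(** * Topological groups, countable neighbourhood bases and sigma-compactness *)

Section topological_groups.
Context {G : topologicalGroupType}.

Lemma continuous_mulg (T : topologicalType) (u v : T -> G) :
  continuous u -> continuous v -> continuous (fun t => u t * v t)%g.
Proof.
move=> cu cv t.
apply: (@continuous_comp _ _ _ (fun t => (u t, v t)) (fun p => p.1 * p.2)%g).
  exact: cvg_pair (cu t) (cv t).
exact: mulg_continuous.
Qed.

Lemma continuous_invg (T : topologicalType) (u : T -> G) :
  continuous u -> continuous (fun t => (u t)^-1)%g.
Proof.
by move=> cu t; apply: continuous_comp (cu t) _; exact: invg_continuous.
Qed.

Lemma lmulg_continuous (g : G) : continuous (fun x => g * x)%g.
Proof. by apply: continuous_mulg => x; [exact: cvg_cst|]. Qed.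

Lemma nbhs_lmulg (g x : G) (A : set G) :
  nbhs (g * x)%g A <-> nbhs x [set y | A (g * y)%g].
Proof.
split=> [/lmulg_continuous//|].
move=> nA; have := @lmulg_continuous g^-1%g (g * x)%g.
rewrite /continuous_at mulKg => /(_ _ nA).
by apply: (@filterS _ (nbhs (g * x)%g)) => y /=; rewrite mulVKg.
Qed.

Lemma nbhs1V (A : set G) : nbhs 1%g A -> nbhs 1%g [set g | A g^-1%g].
Proof. by rewrite -{1}invg1 => /invg_continuous. Qed.

Lemma mulg3_continuous :
  continuous (fun p : G * (G * G) => p.1 * p.2.1 * p.2.2)%g.
Proof.
apply: continuous_mulg; first apply: continuous_mulg.
- by move=> p; exact: cvg_fst.
- by move=> p; apply: continuous_comp; [exact: cvg_snd|exact: cvg_fst].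
- by move=> p; apply: continuous_comp; [exact: cvg_snd|exact: cvg_snd].
Qed.

Lemma nbhs1M3 (A : set G) : nbhs 1%g A -> exists B, [/\ nbhs 1%g B &
  forall a b c, B a -> B b -> B c -> A (a * b * c)%g].
Proof.
move=> A1; have := @mulg3_continuous (1, (1, 1))%g A; rewrite /= !mulg1.
case/(_ A1) => -[B C] /= [B1 [[C1 C2] /= [C11 C21] CC]] BC.
exists (B `&` (C1 `&` C2)); split; first by do 2 apply: filterI => //.
move=> a b c [Ba _] [_ [C1b _]] [_ [_ C2c]]; apply: (BC (a, (b, c))).
by split => //; exact: (CC (b, c)).
Qed.

Lemma compactM3 (A : set G) : compact A -> compact
  [set p.1 * p.2.1 * p.2.2 | p in A `*` (A `*` A)]%g.
Proof.
move=> cA; apply: continuous_compact; last by do ?apply: compact_setX.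
by apply: continuous_subspaceT; exact: mulg3_continuous.
Qed.

End topological_groups.

Lemma second_countable_nbhs_seq (T : topologicalType) (x : T) :
  @second_countable T -> exists B : nat -> set T,
    (forall n, nbhs x (B n)) /\ forall A, nbhs x A -> exists n, B n `<=` A.
Proof.
move=> [b /countable_injP [i iinj] [bopen bx]].
(* Countability is an injection [i] into the naturals; index [n] retrieves the basic set coded by
   [n]. The default [setT] is still a neighbourhood. *)
exists (fun n => xget setT [set U | [/\ b U, U x & i U = n]]); split=> [n|A].
  case: xgetP => [U _ [/bopen oU Ux _]|_]; last exact: filterT.
  exact: open_nbhs_nbhs.
move=> /bx [U [bU Ux] UA]; exists (i U).
case: xgetP => [V _ [bV _ iVU]|/(_ U)]; last by case.
by rewrite (iinj _ _ _ _ iVU) ?inE.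
Qed.

Lemma locally_compact_nbhs (T : topologicalType) (x : T) :
  locally_compact [set: T] -> exists2 C, nbhs x C & compact C.
Proof.
move=> /(_ x I) [C xC [cC _]]; exists C => //.
by apply: (@filterS _ (nbhs x)) xC => y; exact.
Qed.

Lemma second_countable_sigma_compact (T : topologicalType) :
  @second_countable T -> locally_compact [set: T] ->
  exists C : nat -> set T, (forall n, compact (C n)) /\
    forall x, exists n, C n x.
Proof.
move=> [b /countable_injP [i iinj] [bopen bx]] lcT.
(* A compact set around the basic set coded by [n]; the one picked may differ from the one at hand
   but covers the same basic set. The default [set0] is compact. *)
exists (fun n => xget set0 [set C | compact C /\
  exists U, [/\ b U, U `<=` C & i U = n]]); split=> [n|x].
  by case: xgetP => [C _ []//|_]; exact: compact0.
have [C /bx [U [bU Ux] UC] cC] := locally_compact_nbhs x lcT.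
exists (i U); case: xgetP => [D _ [_ [V [bV VD iVU]]]|/(_ C) []].
  by apply: VD; rewrite (iinj _ _ _ _ iVU) ?inE.
by split => //; exists U.
Qed.

(** * The two-sided sequence of sets behind the metric *)

Section struble_sets.
Context {G : topologicalGroupType}.

(** Supplies the negative indices: each step takes a neighbourhood whose triple products stay in the
    previous one, cut down by [B n], which will run through a basis at 1. *)
Lemma shrinking_nbhs (A0 : set G) (B : nat -> set G) :
  nbhs 1%g A0 -> (forall n, nbhs 1%g (B n)) ->
  exists V : nat -> set G, [/\ V 0%N = A0, forall n, nbhs 1%g (V n),
    forall n, V n.+1 `<=` B n &
    forall n a b c, V n.+1 a -> V n.+1 b -> V n.+1 c -> V n (a * b * c)%g].
Proof.
move=> A01 B1.
have /choice[r rP] : forall A : set G, exists C, nbhs 1%g A -> nbhs 1%g C /\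
    forall a b c, C a -> C b -> C c -> A (a * b * c)%g.
  move=> A; have [/nbhs1M3[C [C1 CA]]|nA] := pselect (nbhs (1 : G)%g A).
    by exists C.
  by exists A => /nA.
pose fix V n := if n is m.+1 then r (V m) `&` B m else A0.
have V1 n : nbhs 1%g (V n).
  by elim: n => //= n /rP [rV _]; exact: filterI.
exists V; split => // [n x []//|n a b c [ra _] [rb _] [rc _]].
by have [_] := rP _ (V1 n); apply.
Qed.

(** Supplies the nonnegative indices: triple products enlarge the sets, and adjoining [C n] makes
    them exhaust the group once the [C n] cover it. *)
Lemma growing_compacts (A0 : set G) (C : nat -> set G) :
  compact A0 -> A0 1%g -> (forall n, compact (C n)) ->
  exists W : nat -> set G, [/\ W 0%N = A0, forall n, W n 1%g,
    forall n, compact (W n), forall n, C n `<=` W n.+1 &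
    forall n a b c, W n a -> W n b -> W n c -> W n.+1 (a * b * c)%g].
Proof.
move=> cA0 A01 cC.
pose cube (A : set G) := [set p.1 * p.2.1 * p.2.2 | p in A `*` (A `*` A)]%g.
pose fix W n := if n is m.+1 then cube (W m) `|` C m else A0.
have cubeP A a b c : A a -> A b -> A c -> cube A (a * b * c)%g.
  by move=> Aa Ab Ac; exists (a, (b, c)).
exists W; split => // [n|n|n x|n a b c Wa Wb Wc].
- elim: n => //= n W1; left; rewrite -[1%g]mulg1 -[X in (X * _)%g]mulg1.
  exact: cubeP.
- by elim: n => //= n cW; apply: compactU => //; exact: compactM3.
- by right.
- by left; exact: cubeP.
Qed.

(** The two sequences share the set [K] at index 0 and are glued there; intersecting with inverses
    then gives symmetry. *)
Lemma struble_sets : hausdorff_space G -> locally_compact [set: G] ->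
  @second_countable G -> exists U : int -> set G,
  [/\ forall n, nbhs 1%g (U n) /\ exists2 C, compact C & U n `<=` C,
      forall n g, U n g -> U n g^-1%g,
      forall n a b c, U n a -> U n b -> U n c -> U (n + 1) (a * b * c)%g,
      forall g, exists n, U n g &
      forall A, nbhs 1%g A -> exists n, U n `<=` A].
Proof.
move=> hG lcG scG.
have [B [B1 BA]] := second_countable_nbhs_seq 1%g scG.
have [C [cC CG]] := second_countable_sigma_compact scG lcG.
have [K K1 cK] := locally_compact_nbhs 1%g lcG.
have [V [V0 V1 VB VM]] := shrinking_nbhs K1 B1.
have [W [W0 W1 cW CW WM]] := growing_compacts cK (nbhs_singleton K1) cC.
(* [Negz n] is -(n+1), so it carries [V n.+1]; as V 0 = W 0, the product rule also holds from -1 to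
   0. *)
pose U n := match n with Posz n => W n | Negz n => V n.+1 end.
have UM n a b c : U n a -> U n b -> U n c -> U (n + 1) (a * b * c)%g.
  case: n => [n|[|n]]; last first.
  - have -> : Negz n.+1 + 1 = Negz n by lia.
    exact: VM.
  - have -> : Negz 0 + 1 = 0%N by lia.
    by rewrite /= W0 -V0; exact: VM.
  - by rewrite -PoszD addn1; exact: WM.
have WS n g : W n g -> W n.+1 g.
  by move=> Wg; rewrite -[g]mulg1 -[g]mulg1; exact: WM.
have WK n : K `<=` W n.
  elim: n => [|n ih] x Kx; first by rewrite W0.
  exact/WS/ih.
have VK n : V n `<=` K.
  elim: n => [|n ih] x Vx; first by rewrite -V0.
  apply: ih; rewrite -[x]mulg1 -[x]mulg1.
  by apply: VM => //; exact: nbhs_singleton.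
have nU n : nbhs 1%g (U n).
  by case: n => [n|n] /=; [exact: filterS K1|exact: V1].
exists (fun n => [set g | U n g /\ U n g^-1%g]); split.
- move=> n; split; first by apply: filterI => //; exact: nbhs1V.
  case: n => n; first by exists (W n) => // g [].
  by exists K => // g [/VK].
- by move=> n g []; rewrite /= invgK.
- move=> n a b c [a1 a2] [b1 b2] [c1 c2]; split; first exact: UM.
  by rewrite !invgM mulgA; exact: UM.
- move=> g; have [m Cm] := CG g; have [n Cn] := CG g^-1%g.
  have WD k l x : W k x -> W (k + l)%N x.
    move=> Wx; elim: l => [|l ih]; first by rewrite addn0.
    by rewrite addnS; exact: WS.
  exists (m.+1 + n.+1)%N; split => /=; first exact/WD/CW.
  by rewrite addnC; exact/WD/CW.
- by move=> A /BA[n BnA]; exists (Negz n) => g [/VB/BnA].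
Qed.

End struble_sets.

(** * The dyadic weight and the Birkhoff-Kakutani-Struble metric *)

Lemma exists_exprz2_lt (R : realType) (e : R) : 0 < e ->
  exists n : int, 2 ^ n < e.
Proof.
move=> e0; exists (- (Num.truncn e^-1).+1%:Z); rewrite -exprnN.
rewrite invf_plt ?posrE ?exprn_gt0//.
apply: lt_trans (truncnS_gt _) _.
by rewrite -natrX ltr_nat ltn_expl.
Qed.

Lemma exists_exprz2_gt (R : realType) (t : R) : exists n : int, t < 2 ^ n.
Proof.
exists (Num.truncn t).+1%:Z; rewrite -exprnP.
apply: lt_trans (truncnS_gt _) _.
by rewrite -natrX ltr_nat ltn_expl.
Qed.

Section weight.
Context {R : realType} {G : topologicalGroupType} (U : int -> set G).
Hypothesis nU : forall n, nbhs 1%g (U n).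
Hypothesis UV : forall n g, U n g -> U n g^-1%g.
Hypothesis UM : forall n a b c,
  U n a -> U n b -> U n c -> U (n + 1) (a * b * c)%g.
Hypothesis UG : forall g, exists n, U n g.
Hypothesis U1 : forall A, nbhs 1%g A -> exists n, U n `<=` A.

(* With a supremum over the sets that miss [g], instead of an infimum over
   those that contain it, [weight g <= t] just says that [U n g] whenever
   [t < 2 ^ n]. *)
Definition weight (g : G) : R :=
  sup (0 |` [set 2 ^ n | n in [set n | ~ U n g]]).

Lemma sets_monotone m n : m <= n -> U m `<=` U n.
Proof.
move=> mn; have -> : n = m + `|n - m|%N%:Z by lia.
elim: `|n - m|%N => [|k ih] g Ug; first by rewrite addr0.
have -> : m + k.+1%:Z = m + k%:Z + 1 by lia.
rewrite -[g]mulg1 -[g]mulg1.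
by apply: UM; [exact: ih|exact: nbhs_singleton|exact: nbhs_singleton].
Qed.

Lemma weight_ubound m g : U m g ->
  ubound (0 |` [set 2 ^ n | n in [set n | ~ U n g]]) (2 ^ (m - 1) : R).
Proof.
move=> Umg _ [->|[n nU' <-]]; first exact: exprz_ge0.
rewrite ler_eXz2l ?ltr1n//; have [//|mn] := lerP n (m - 1).
by exfalso; apply/nU'/(sets_monotone _ Umg); lia.
Qed.

Lemma weight_has_sup g :
  has_sup (0 |` [set 2 ^ n | n in [set n | ~ U n g]] : set R).
Proof.
split; first by exists 0; left.
by have [m Um] := UG g; exists (2 ^ (m - 1)); exact: weight_ubound.
Qed.

Lemma weight_ge0 g : 0 <= weight g.
Proof. by apply: sup_upper_bound; [exact: weight_has_sup|left]. Qed.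

Lemma weight_notin n g : ~ U n g -> 2 ^ n <= weight g.
Proof.
by move=> nUg; apply: sup_upper_bound; [exact: weight_has_sup|right; exists n].
Qed.

Lemma weight_in n g : weight g < 2 ^ n -> U n g.
Proof.
by move=> wn; apply: contrapT => /weight_notin; rewrite leNgt wn.
Qed.

Lemma weight_le t g : 0 <= t -> (forall n, ~ U n g -> 2 ^ n <= t) ->
  weight g <= t.
Proof.
move=> t0 tn; apply: sup_le_ub; first by exists 0; left.
by move=> _ [->//|[n nUg <-]]; exact: tn.
Qed.

Lemma weight1 : weight 1%g = 0.
Proof.
apply/le_anti; rewrite weight_ge0 andbT; apply: weight_le => // n.
by case; exact: nbhs_singleton.
Qed.

Lemma weightV g : weight g^-1%g = weight g.
Proof.
suff le_V h : weight h^-1%g <= weight h.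
  by apply/le_anti; rewrite le_V -{1}(invgK g) le_V.
apply: weight_le (weight_ge0 _) _ => n nU'; apply: weight_notin => Uh.
by apply: nU'; exact: UV.
Qed.

Lemma weightM3 t a b c : weight a <= t -> weight b <= t -> weight c <= t ->
  weight (a * b * c)%g <= 2 * t.
Proof.
move=> ta tb tc; have t0 := le_trans (weight_ge0 a) ta.
apply: weight_le => [|n nUabc]; first lra.
rewrite leNgt; apply/negP => tn; apply: nUabc.
(* From 2t < 2^n all three factors lie in [U (n - 1)], so their product lies in [U n]. *)
have t2 : t < 2 ^ (n - 1).
  by rewrite expfzDr// -invr_expz expr1z ltr_pdivlMr// mulrC.
by rewrite -(subrK 1 n); apply: UM; apply: weight_in; exact: le_lt_trans t2.
Qed.

Lemma weight_nbhs e : 0 < e -> nbhs 1%g [set g | weight g < e].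
Proof.
move=> /exists_exprz2_lt[n ne]; apply: filterS (nU n) => g Ug /=.
apply: le_lt_trans ne; apply: weight_le => [|m nUm]; first exact: exprz_ge0.
rewrite ler_eXz2l ?ltr1n// leNgt; apply/negP => nm.
by apply/nUm/(sets_monotone _ Ug)/ltW.
Qed.

Lemma nbhs_weight A : nbhs 1%g A ->
  exists2 e, 0 < e & [set g | weight g < e] `<=` A.
Proof.
move=> /U1[n nA]; exists (2 ^ n); first exact: exprz_gt0.
by move=> g /weight_in/nA.
Qed.

Definition struble_dist (x y : G) : R := chain_norm weight (x^-1 * y)%g.

Let N := @chain_norm R G weight.
Let N_le g : N g <= weight g.
Proof. exact: chain_norm_le_weight weight_ge0 _. Qed.
Let w_le g : weight g <= 2 * N g.
Proof. exact: (weight_le_chain_norm weight_ge0 weight1 weightM3). Qed.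

Lemma struble_dist_metric : hausdorff_space G -> is_metric struble_dist.
Proof.
rewrite /struble_dist; move=> hG; split=> [x|x y xy|x y|x y z].
- by rewrite mulVg chain_norm1 //; [exact: weight_ge0|exact: weight1].
(* At distance 0, [x^-1 * y] has weight 0 and lies in every neighbourhood of 1, so [x] and [y]
   cannot be separated. *)
- apply/esym/hG/(_ : cluster (nbhs y) x) => A B yA xB.
  exists y; split; first exact: nbhs_singleton.
  move: xB; rewrite -{1}[x]mulg1 => /nbhs_lmulg/nbhs_weight[e e0 eB].
  rewrite -[y](mulVKg x); apply: eB => /=.
  by apply: le_lt_trans (w_le _) _; rewrite /N xy mulr0.
- by rewrite -chain_normV ?invgM ?invgK//; [exact: weight_ge0|exact: weightV].
- rewrite -[X in X <= _]/(N _).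
  have -> : (x^-1 * z = (x^-1 * y) * (y^-1 * z))%g.
    by rewrite mulgA mulgK.
  exact: chain_normM weight_ge0 _ _.
Qed.

Lemma struble_dist_left_invariant : left_invariant struble_dist.
Proof. by move=> g x y; rewrite /struble_dist invgM -mulgA mulKg. Qed.

Lemma struble_dist_compatible : compatible_metric struble_dist.
Proof.
move=> x; apply/seteqP; split=> A.
  rewrite -{1}[x]mulg1 => /nbhs_lmulg/nbhs_weight[e e0 eA].
  exists (e / 2) => /=; first lra.
  move=> y /= xy; rewrite -[y](mulVKg x); apply: eA => /=.
  by have := w_le (x^-1 * y)%g; move: xy; rewrite /struble_dist -/N; lra.
move=> [e /= e0 eA]; rewrite -[x]mulg1; apply/nbhs_lmulg.
apply: (@filterS _ (nbhs (1%g : G))) (weight_nbhs e0) => g /= ge.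
apply: eA => /=.
by rewrite /struble_dist mulKg; apply: le_lt_trans (N_le _) ge.
Qed.

(** For properness: a ball lies in a translate of some [U n], and the sets from [struble_sets] sit
    inside compact ones. *)
Lemma struble_dist_ball (x : G) (r : R) :
  exists n, forall y, struble_dist x y <= r -> U n (x^-1 * y)%g.
Proof.
have [n rn] := exists_exprz2_gt (2 * r); exists n => y xy; apply: weight_in.
by apply: le_lt_trans (w_le _) _; move: xy; rewrite /struble_dist -/N; lra.
Qed.

End weight.

(** * Metric balls, boundedness and existence of admissible metrics *)

Section compatible_metrics.
Context {R : realType} {T : topologicalType} (d : T -> T -> R).
Hypothesis d_metric : is_metric d.
Hypothesis d_compatible : compatible_metric d.

Lemma metric_ge0 x y : 0 <= d x y.
Proof.
have := is_metric_triangle d_metric x y x.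
by rewrite (is_metric_refl d_metric) (is_metric_sym d_metric y x); lra.
Qed.

Lemma nbhs_metric_ball x e : 0 < e -> nbhs x [set y | d x y < e].
Proof. by move=> e0; rewrite d_compatible; exists e. Qed.

Lemma closed_metric_ball x r : closed [set y | d x y <= r].
Proof.
move=> y cly; rewrite /= leNgt; apply/negP => ry.
have [z [/= xz yz]] := cly _ (@nbhs_metric_ball y (d x y - r) ltac:(lra)).
have := is_metric_triangle d_metric x z y; rewrite (is_metric_sym d_metric z y).
by move: yz; rewrite /=; lra.
Qed.

Lemma compact_metric_bounded x (K : set T) : compact K ->
  exists r, forall y, K y -> d x y <= r.
Proof.
(* Compactness is used in covering form along [r] to +oo: around [y], every [r] above [d x y + 1]
   works. *)
move=> /compact_near_coveringP/(_ R (pinfty_nbhs R) (fun r y => d x y <= r)).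
case=> [y Ky|r [_]].
  exists ([set z | d y z < 1], [set r | d x y + 1 < r]) => /=.
    by split; [exact: nbhs_metric_ball|exists (d x y + 1); rewrite num_real].
  move=> [z r] /= [yz xyr]; have := is_metric_triangle d_metric x y z; lra.
move=> rK; exists (r + 1); exact: (rK (r + 1) ltac:(lra)).
Qed.

End compatible_metrics.

Lemma exists_admissible_metric (R : realType) (G : topologicalGroupType) :
  hausdorff_space G -> locally_compact [set: G] -> @second_countable G ->
  exists d : G -> G -> R, admissible_metric d.
Proof.
move=> hG lcG scG.
have [U [/all_and2[nU UC] UV UM UG U1]] := struble_sets hG lcG scG.
pose d : G -> G -> R := struble_dist U.
have dm : is_metric d by exact: struble_dist_metric.
have dc : compatible_metric d by exact: struble_dist_compatible.
exists d; split => //; first exact: struble_dist_left_invariant.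
move=> x r; have [n xU] := struble_dist_ball nU UM UG x r.
have [C cC UnC] := UC n.
apply: (@subclosed_compact _ _ [set x * y | y in C]%g).
- exact: closed_metric_ball.
- apply: continuous_compact => //; apply: continuous_subspaceT.
  exact: lmulg_continuous.
- by move=> y /xU/UnC Cxy; exists (x^-1 * y)%g => //; rewrite mulVKg.
Qed.

(** * Coarse equivalence in terms of uniform bounds *)

Lemma controlledP (R : realType) (T : Type) (u v : T -> R) :
  (forall t : nat -> T,
    (u (t n) @[n --> \oo] --> +oo) -> (v (t n) @[n --> \oo] --> +oo)) <->
  forall r, exists s, forall t, v t <= r -> u t <= s.
Proof.
split=> [uv r|vu t /cvgryPge ut].
- apply: contrapT => /forallNP nr.
  (* If no bound works for [r], each [n] yields a point with [v] at most [r] and [u] above [n];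
     along these [u] diverges while [v] does not. *)
  have /choice[t tP] : forall n : nat, exists t, v t <= r /\ n%:R < u t.
    move=> n; have /existsNP[t /not_implyP[vt /negP]] := nr n%:R.
    by rewrite -ltNge; exists t.
  have /uv/cvgryPge/(_ (r + 1))/filter_ex[n] : u (t n) @[n --> \oo] --> +oo.
    apply/cvgryPge => A; near=> n; apply: ltW; apply: le_lt_trans (tP n).2.
    by near: n; exact: nbhs_infty_ger.
  by have [] := tP n; lra.
- apply/cvgryPge => A; have [s sP] := vu A.
  have := ut (s + 1); apply: filterS => n us; rewrite leNgt; apply/negP => vA.
  by have := sP _ (ltW vA); lra.
Unshelve. all: by end_near. Qed.

Lemma coboundedP (R : realType) (T : Type) (d : T -> T -> R) (A : set T) :
  cobounded d A <-> exists r, forall y, exists2 a, A a & d y a <= r.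
Proof.
split=> [coA|[r rP]].
- have [r supr] : exists r : R,
      (ereal_sup [set dist_to_set d y A | y in [set: T]] < r%:E)%E.
    move: coA; rewrite /cobounded; case: ereal_sup => [r _|//|_].
      by exists (r + 1); rewrite lte_fin; lra.
    by exists 0; rewrite ltNyr.
  exists r => y; have : (dist_to_set d y A < r%:E)%E.
    by apply: le_lt_trans supr; apply: ereal_sup_ubound; exists y.
  by move=> /ereal_inf_lt[_ [a Aa <-]]; rewrite lte_fin => /ltW; exists a.
- apply: (@le_lt_trans _ _ r%:E); last exact: ltry.
  apply: ge_ereal_sup => _ [y _ <-]; have [a Aa yar] := rP y.
  by apply: (@le_trans _ _ (d y a)%:E) => //; apply: ereal_inf_lbound; exists a.
Qed.

(** Each implication between divergences is [controlledP] on pairs. The directions swap: divergence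
    of [dX] forcing that of [dY] means that bounds on [dY] give bounds on [dX]. *)
Lemma coarse_equivalenceP (R : realType) (X Y : Type) (dX : X -> X -> R)
    (dY : Y -> Y -> R) (phi : X -> Y) :
  coarse_equivalence dX dY phi <->
  [/\ exists r, forall y, exists x, dY y (phi x) <= r,
      forall r, exists s, forall x z, dX x z <= r -> dY (phi x) (phi z) <= s &
      forall r, exists s, forall x z, dY (phi x) (phi z) <= r -> dX x z <= s].
Proof.
pose u (p : X * X) := dX p.1 p.2; pose v (p : X * X) := dY (phi p.1) (phi p.2).
have cuv := controlledP u v; have cvu := controlledP v u.
split=> [[/coboundedP[r rP] seqP]|[[r rP] c1 c2]].
- split.
  + by exists r => y; have [_ [x _ <-]] := rP y; exists x.
  + move=> t; have [s sP] := cvu.1 (fun p => (seqP (fst \o p) (snd \o p)).2) t.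
    by exists s => x z; exact: (sP (x, z)).
  + move=> t; have [s sP] := cuv.1 (fun p => (seqP (fst \o p) (snd \o p)).1) t.
    by exists s => x z; exact: (sP (x, z)).
- split=> [|x z].
    by apply/coboundedP; exists r => y; have [x] := rP y; exists (phi x).
  split; [apply: (cuv.2 _ (fun n => (x n, z n)))|
          apply: (cvu.2 _ (fun n => (x n, z n)))] => t.
  + by have [s sP] := c2 t; exists s => -[]; exact: sP.
  + by have [s sP] := c1 t; exists s => -[]; exact: sP.
Qed.

(** * From a coupling to a coarse equivalence *)

Lemma coupling_coarsely_equivalent (R : realType) (G H : topologicalGroupType)
    (dG : G -> G -> R) (dH : H -> H -> R) :
  admissible_metric dG -> admissible_metric dH ->
  admit_topological_coupling G H ->
  exists phi : H -> G, coarse_equivalence dH dG phi.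
Proof.
move=> [mG cG lG pG] [mH cH lH pH] [X [l [r [[x0 _] _ _ [l1 lM] [r1 rM] lr lc rc
  lp rp [K [cK XGK XKH]]]]]].
have /choice[phi phiP] : forall h, exists g, K (l g^-1%g (r x0 h)).
  move=> h; have : [set: X] (r x0 h) by [].
  by rewrite XGK => -[g _ [y Ky <-]]; exists g; rewrite -lM mulVg l1.
(* [k h] is the component in [K] of [x0 h]. By [kE], a displacement in [H] on the right of a point
   of [K] matches one in [G] on the left of another, which lets properness compare them. *)
pose k h := l (phi h)^-1%g (r x0 h).
have kE h h' : r (k h) (h^-1 * h')%g = l ((phi h)^-1 * phi h')%g (k h').
  by rewrite lr -rM mulVKg lM /k -[in RHS](lM (phi h')) mulgV l1.
have dHE h h' : dH h h' = dH 1%g (h^-1 * h')%g by rewrite -(lH h^-1%g) mulVg.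
have dGE g g' : dG g g' = dG 1%g (g^-1 * g')%g by rewrite -(lG g^-1%g) mulVg.
exists phi; apply/coarse_equivalenceP; split.
(* Write g^-1 x0 = y h with y in [K]. Then g^-1 phi(h^-1) carries [k h^-1] to [y], so properness
   bounds it. *)
- have [s sP] := compact_metric_bounded mG cG 1%g (lp _ cK).
  exists s => g; have : [set: X] (l g^-1%g x0) by [].
  rewrite XKH => -[y Ky [h _ yh]]; exists h^-1%g.
  rewrite dGE; apply: sP; exists y; split => //.
  exists (k h^-1%g); first exact: phiP.
  by rewrite /k -lM mulgK -lr -yh -rM mulgV r1.
- move=> t.
  (* [M] contains [K] and all [k h] moved by at most [t], so phi(h)^-1 phi(h') is a return element
     of [M]. *)
  pose M := K `|` [set r p.1 p.2 | p in K `*` [set h | dH 1%g h <= t]].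
  have cM : compact M.
    apply: compactU => //; apply: continuous_compact.
      exact: continuous_subspaceT.
    by apply: compact_setX => //; exact: pH.
  have [s sP] := compact_metric_bounded mG cG 1%g (lp _ cM).
  exists s => h h' hh'; rewrite dGE; apply: sP.
  exists (r (k h) (h^-1 * h')%g); split.
    by exists (k h'); [left; exact: phiP|rewrite kE].
  right; exists (k h, h^-1 * h')%g => //; split; first exact: phiP.
  by rewrite /= -dHE.
- move=> t.
  pose M := K `|` [set l p.1 p.2 | p in [set g | dG 1%g g <= t] `*` K].
  have cM : compact M.
    apply: compactU => //; apply: continuous_compact.
      exact: continuous_subspaceT.
    by apply: compact_setX => //; exact: pG.
  have [s sP] := compact_metric_bounded mH cH 1%g (rp _ cM).
  exists s => h h' hh'; rewrite dHE; apply: sP.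
  exists (r (k h) (h^-1 * h')%g); split.
    by exists (k h) => //; left; exact: phiP.
  right; exists ((phi h)^-1 * phi h', k h')%g => //; split; last exact: phiP.
  by rewrite /= -dGE.
Qed.

(** * Ultrafilter limits, return sets and pointwise convergence *)

Lemma ultra_cvg_compact (S : Type) (T : topologicalType) (F : set_system S)
    (f : S -> T) (K : set T) :
  UltraFilter F -> compact K -> F (f @^-1` K) -> exists2 y, K y & f @ F --> y.
Proof.
move=> FU cK FK; have [y [Ky yF]] := cK (f @ F) _ FK.
exists y => // B yB; have [//|FnB] := in_ultra_setVsetC (f @^-1` B) FU.
by have [z []] := yF (~` B) B FnB yB.
Qed.

(** A bound on the return set only gives relative compactness; being the projection of a closed
    subset of the product of [B] and [K] makes it compact. *)
Lemma compact_return_set (T X : topologicalType) (f : T -> X -> X) (K : set X)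
    (B : set T) :
  hausdorff_space X -> continuous (fun p : T * X => f p.1 p.2) ->
  compact K -> compact B -> [set t | (f t @` K) `&` K !=set0] `<=` B ->
  compact [set t | (f t @` K) `&` K !=set0].
Proof.
move=> hX cf cK cB sB.
have -> : [set t | (f t @` K) `&` K !=set0] =
    fst @` ((B `*` K) `&` [set p | K (f p.1 p.2)]).
  apply/seteqP; split=> t.
    move=> tK; have Bt := sB _ tK; case: tK => _ [[x Kx <-] Kfx].
    by exists (t, x).
  by move=> [[u x] [[_ Kx] Kfx] <-]; exists (f u x); split => //; exists x.
apply: continuous_compact.
  by apply: continuous_subspaceT => p; exact: cvg_fst.
apply: compact_closedI; first exact: compact_setX.
by apply: (closed_comp (fun p _ => cf p)); exact: compact_closed.
Qed.

Section pointwise_subspaces.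
Context {R : realType} {I : topologicalType} (A : set {ptws I -> R}).

Lemma cvg_set_typeP (F : set_system A) (D : A) : Filter F ->
  F --> D <-> forall p, (\val E p : R) @[E --> F] --> (\val D p : R).
Proof.
move=> FF; have <- : (set_val @ F --> (set_val D : {ptws I -> R})) <->
    forall p, (\val E p : R) @[E --> F] --> (\val D p : R).
  exact: (@pointwise_cvgP I R (set_val @ F) (set_val D)).
split=> [FD|FD B].
  by apply: cvg_comp FD _; exact: initial_continuous.
rewrite nbhsE => -[C [[C' oC' <-] C'D] CB].
apply: (@filterS _ F) CB _; apply: FD; exact: open_nbhs_nbhs.
Qed.

Lemma set_type_continuous (T : topologicalType) (f : T -> A) :
  (forall p, continuous (fun t => \val (f t) p : R)) -> continuous f.
Proof. by move=> cf t; apply/cvg_set_typeP => p; exact: cf. Qed.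

Lemma eval_set_type_continuous p : continuous (fun D : A => \val D p : R).
Proof. by move=> D; have /cvg_set_typeP := @cvg_id _ (nbhs D); exact. Qed.

Lemma nbhs_eval_lt (D : A) p (e : R) : 0 < e ->
  \forall E \near D, `|\val D p - \val E p| < e.
Proof.
move=> e0; have /cvgrPdist_lt := @eval_set_type_continuous p D.
exact.
Qed.

Lemma hausdorff_set_type : hausdorff_space A.
Proof.
move=> D E DE; apply/val_inj/funext => p; apply: contrapT => /eqP.
rewrite -subr_eq0 -normr_gt0 => e0.
have e2 : 0 < `|\val D p - \val E p| / 2 by lra.
have [C [/= DC EC]] := DE _ _ (nbhs_eval_lt D p e2) (nbhs_eval_lt E p e2).
have := ler_distD (\val C p) (\val D p) (\val E p).
by rewrite (distrC (\val C p)); move: DC EC; lra.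
Qed.

End pointwise_subspaces.

(** * The space of profiles and the translations on it *)

Section coarse_profiles.
Context {R : realType} {G H : topologicalGroupType}.
Variables (dG : G -> G -> R) (dH : H -> H -> R) (c : R) (rho : R -> R -> R).
Hypothesis admG : admissible_metric dG.
Hypothesis admH : admissible_metric dH.

Let mG := admissible_is_metric admG.
Let mH := admissible_is_metric admH.
Let cG := admissible_compatible admG.
Let cH := admissible_compatible admH.

(* [D] plays the role of the distance to a coarse graph in [H * G]. The
   inequalities [D p < a] are strict so that they survive pointwise limits. *)
Record is_profile (D : H * G -> R) : Prop := IsProfile {
  profile_ge0 : forall p, 0 <= D p ;
  profile_lip : forall p q, D p <= D q + (dH p.1 q.1 + dG p.2 q.2) ;
  profile_totalH : forall h, exists g, D (h, g) <= c ;
  profile_totalG : forall g, exists h, D (h, g) <= c ;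
  profile_controlG : forall a t p q, D p < a -> D q < a ->
    dH p.1 q.1 <= t -> dG p.2 q.2 <= rho a t ;
  profile_controlH : forall a t p q, D p < a -> D q < a ->
    dG p.2 q.2 <= t -> dH p.1 q.1 <= rho a t
}.

Definition profiles : set {ptws (H * G)%type -> R} := is_profile.

Lemma profileP (D : profiles) : is_profile (\val D).
Proof. exact: set_mem (valP D). Qed.

(** Joint continuity comes from the common Lipschitz bound: one third of [e] for moving [D] at [p],
    the other two for moving [p] in its two coordinates. *)
Lemma eval_profile_continuous :
  continuous (fun z : profiles * (H * G) => \val z.1 z.2 : R).
Proof.
move=> [D p]; apply/cvgrPdist_lt => e e0 /=.
have e3 : 0 < e / 3 by lra.
exists ([set E | `|\val D p - \val E p| < e / 3],
  [set q : H * G | dH p.1 q.1 < e / 3 /\ dG p.2 q.2 < e / 3]) => /=.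
  split; first exact: nbhs_eval_lt.
  exists ([set h | dH p.1 h < e / 3], [set g | dG p.2 g < e / 3]) => //=.
  by split; apply: nbhs_metric_ball.
move=> [E q] /= [DE [h g]].
have := profile_lip (profileP E) p q; have := profile_lip (profileP E) q p.
rewrite (is_metric_sym mH q.1) (is_metric_sym mG q.2).
move: DE; rewrite !ltr_norml => /andP[D1 D2].
by move=> /= qp pq; apply/andP; split; lra.
Qed.

(** The Lipschitz bound keeps each value in a segment, so ultrafilter limits exist pointwise. The
    totality clauses are existential, so their witnesses must converge too; control confines these
    to a compact ball. *)
Lemma compact_profiles N : compact [set D : profiles | \val D (1, 1)%g <= N].
Proof.
rewrite compact_ultra => F FU FN.
pose dist (p : H * G) : R := dH p.1 1%g + dG p.2 1%g.
have /choice[D DP] : forall p, exists y : R,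
    0 <= y /\ (\val E p : R) @[E --> F] --> y.
  move=> p; have [|y yK yF] := @ultra_cvg_compact _ R F
      (fun E : profiles => \val E p : R) `[0, N + dist p] FU
      (@segment_compact _ _ _).
    apply: (@filterS _ F) FN => E /= EN; rewrite in_itv/=.
    rewrite (profile_ge0 (profileP E))/=.
    by apply: le_trans (profile_lip (profileP E) p (1, 1)%g) _; rewrite lerD2r.
  by exists y; split => //; move: yK; rewrite /= in_itv => /andP[].
have nD p e : 0 < e -> F [set E : profiles | `|D p - \val E p| < e].
  by move=> e0; have [_ /cvgrPdist_lt] := DP p; exact.
have FltD p a : D p < a -> F [set E : profiles | \val E p < a].
  move=> pa; apply: (@filterS _ F) (nD p (a - D p) ltac:(lra)) => E /=.
  by rewrite ltr_norml => /andP[]; lra.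
have DP' : is_profile D.
  split.
  - by move=> p; have [] := DP p.
  - move=> p q; apply/ler_addgt0Pr => e e0; have e2 : 0 < e / 2 by lra.
    have [E [/= Ep Eq]] := filter_ex (filterI (nD p _ e2) (nD q _ e2)).
    have /= := profile_lip (profileP E) p q.
    by move: Ep Eq; rewrite !ltr_norml => /andP[+ +] /andP[]; lra.
  - move=> h.
    have /choice[gam gamP] : forall E : profiles, exists g, \val E (h, g) <= c.
      by move=> E; exact: profile_totalH (profileP E) h.
    (* Above both [N] and [c], so that control applies strictly to (1, 1) and to the witness at
       [h]. *)
    pose a := Num.max N c + 1.
    have [|g _ gF] := @ultra_cvg_compact _ G F gam
        [set g | dG 1%g g <= rho a (dH 1%g h)] FU
        (@admissible_proper _ _ _ admG _ _).
      apply: (@filterS _ F) FN => E /= EN.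
      apply: (@profile_controlG _ (profileP E) a _ (1, 1)%g (h, gam E)) => //=.
        by apply: le_lt_trans EN _; rewrite /a ltr_pwDr// le_max lexx.
      by apply: le_lt_trans (gamP E) _; rewrite /a ltr_pwDr// le_max lexx orbT.
    (* The limit [g] works: D(h, g) exceeds E(h, g) by at most e/2, which exceeds E(h, [gam E]) by
       at most another e/2. *)
    exists g; apply/ler_addgt0Pr => e e0; have e2 : 0 < e / 2 by lra.
    have [E [/= Ep Eg]] := filter_ex (@filterI _ F _ _ _ (nD (h, g) _ e2)
      (gF _ (nbhs_metric_ball cG g e2))).
    have /= := profile_lip (profileP E) (h, g) (h, gam E); have := gamP E.
    rewrite /= (is_metric_refl mH).
    by move: Ep Eg; rewrite !ltr_norml => /andP[+ +]; lra.
  - move=> g.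
    have /choice[eta etaP] : forall E : profiles, exists h, \val E (h, g) <= c.
      by move=> E; exact: profile_totalG (profileP E) g.
    pose a := Num.max N c + 1.
    have [|h _ hF] := @ultra_cvg_compact _ H F eta
        [set h | dH 1%g h <= rho a (dG 1%g g)] FU
        (@admissible_proper _ _ _ admH _ _).
      apply: (@filterS _ F) FN => E /= EN.
      apply: (@profile_controlH _ (profileP E) a _ (1, 1)%g (eta E, g)) => //=.
        by apply: le_lt_trans EN _; rewrite /a ltr_pwDr// le_max lexx.
      by apply: le_lt_trans (etaP E) _; rewrite /a ltr_pwDr// le_max lexx orbT.
    exists h; apply/ler_addgt0Pr => e e0; have e2 : 0 < e / 2 by lra.
    have [E [/= Ep Eh]] := filter_ex (@filterI _ F _ _ _ (nD (h, g) _ e2)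
      (hF _ (nbhs_metric_ball cH h e2))).
    have /= := profile_lip (profileP E) (h, g) (eta E, g); have := etaP E.
    rewrite /= (is_metric_refl mG).
    by move: Ep Eh; rewrite !ltr_norml => /andP[+ +]; lra.
  - move=> a t p q pa qa.
    have [E [/= Ep Eq]] := filter_ex (filterI (FltD p a pa) (FltD q a qa)).
    exact: (profile_controlG (profileP E) Ep Eq).
  - move=> a t p q pa qa.
    have [E [/= Ep Eq]] := filter_ex (filterI (FltD p a pa) (FltD q a qa)).
    exact: (profile_controlH (profileP E) Ep Eq).
pose D' : profiles := exist _ (D : {ptws (H * G)%type -> R}) (mem_set DP').
exists D'; split; last by apply/cvg_set_typeP => p; have [] := DP p.
apply/ler_addgt0Pr => e e0 /=.
have [E [/= EN]] := filter_ex (filterI FN (nD (1, 1)%g _ e0)).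
by rewrite ltr_norml => /andP[]; lra.
Qed.

Lemma translate_profile (s : H * G) (D : profiles) :
  is_profile (fun p => \val D (s.1 * p.1, s.2^-1 * p.2)%g).
Proof.
have DP := profileP D; have lG := admissible_left_invariant admG.
have lH := admissible_left_invariant admH.
split=> [p|p q|h|g|a t p q pa qa|a t p q pa qa].
- exact: profile_ge0 DP _.
- have := profile_lip DP (s.1 * p.1, s.2^-1 * p.2)%g (s.1 * q.1, s.2^-1 * q.2)%g.
  by rewrite /= lG lH.
- have [g gc] := profile_totalH DP (s.1 * h)%g.
  by exists (s.2 * g)%g; rewrite /= mulKg.
- have [h hc] := profile_totalG DP (s.2^-1 * g)%g.
  by exists (s.1^-1 * h)%g; rewrite /= mulVKg.
- have := profile_controlG DP (t := t) pa qa.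
  by rewrite /= lG lH.
- have := profile_controlH DP (t := t) pa qa.
  by rewrite /= lG lH.
Qed.

(** Only the [G] coordinate is inverted, so that one map yields a left action of [G] and a right
    action of [H]. *)
Definition translate (s : H * G) (D : profiles) : profiles :=
  exist _ (_ : {ptws (H * G)%type -> R}) (mem_set (translate_profile s D)).

Lemma translateE s D p :
  \val (translate s D) p = \val D (s.1 * p.1, s.2^-1 * p.2)%g.
Proof. by []. Qed.

Lemma translate_continuous (T : topologicalType) (u : T -> H) (v : T -> G)
    (D : T -> profiles) : continuous u -> continuous v -> continuous D ->
  continuous (fun t => translate (u t, v t) (D t)).
Proof.
move=> cu cv cD; apply: set_type_continuous => p.
have cu' : continuous (fun t => u t * p.1)%g.
  by apply: (continuous_mulg cu) => ?; exact: cvg_cst.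
have cv' : continuous (fun t => (v t)^-1 * p.2)%g.
  by apply: (continuous_mulg (continuous_invg cv)) => ?; exact: cvg_cst.
pose w t := (D t, (u t * p.1, (v t)^-1 * p.2)%g).
have cw : continuous w.
  by move=> t; exact: cvg_pair (cD t) (cvg_pair (cu' t) (cv' t)).
by move=> t; exact: continuous_comp (cw t) (@eval_profile_continuous (w t)).
Qed.

End coarse_profiles.

(** * The coupling on the space of profiles *)

Section profile_coupling.
Context {R : realType} {G H : topologicalGroupType}.
Variables (dG : G -> G -> R) (dH : H -> H -> R) (c : R) (rho : R -> R -> R).
Hypothesis admG : admissible_metric dG.
Hypothesis admH : admissible_metric dH.

Let X : topologicalType := profiles dG dH c rho.
Let tr : H * G -> X -> X := translate admG admH.

Lemma compact_profile_bounded (K : set X) : compact K ->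
  exists N, forall D, K D -> \val D (1, 1)%g <= N.
Proof.
move=> cK.
have [M [_ MK]] : bounded_set ((fun D : X => \val D (1, 1)%g : R) @` K).
  apply: compact_bounded; apply: continuous_compact => //.
  by apply: continuous_subspaceT; exact: eval_set_type_continuous.
exists (M + 1) => D KD; apply: le_trans (ler_norm _) _.
by apply: (MK (M + 1)); [lra|exists D].
Qed.

(** If [D] and its translate by [g] lie in [K], then [D] is at most [N] at (1, 1) and at (1, g^-1);
    control with t = 0 bounds [g]. The [N + 1] makes these bounds strict. *)
Lemma left_return_bounded (K : set X) : compact K -> exists r,
  [set g | (tr (1%g, g) @` K) `&` K !=set0] `<=` [set g | dG 1%g g <= r].
Proof.
move=> /compact_profile_bounded[N NK]; exists (rho (N + 1) 0).
move=> g [_ [[D KD <-] /NK trN]]; have DN := NK _ KD.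
rewrite /=; have -> : dG 1%g g = dG 1%g g^-1%g.
  rewrite -[LHS](admissible_left_invariant admG g^-1%g) mulg1 mulVg.
  exact: is_metric_sym (admissible_is_metric admG) _ _.
have lt1 x : x <= N -> x < N + 1 by lra.
move: trN; rewrite translateE /= mulg1 mulg1 => trN.
apply: (profile_controlG (profileP D) (lt1 _ DN) (lt1 _ trN)).
by rewrite /= (is_metric_refl (admissible_is_metric admH)).
Qed.

Lemma right_return_bounded (K : set X) : compact K -> exists r,
  [set h | (tr (h, 1%g) @` K) `&` K !=set0] `<=` [set h | dH 1%g h <= r].
Proof.
move=> /compact_profile_bounded[N NK]; exists (rho (N + 1) 0).
move=> h [_ [[D KD <-] /NK trN]]; have DN := NK _ KD.
have lt1 x : x <= N -> x < N + 1 by lra.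
move: trN; rewrite translateE /= mulg1 mulVg => trN.
apply: (profile_controlH (profileP D) (lt1 _ DN) (lt1 _ trN)).
by rewrite /= (is_metric_refl (admissible_is_metric admG)).
Qed.

Lemma translate1 D : tr (1, 1)%g D = D.
Proof.
by apply/val_inj/funext => -[h g]; rewrite translateE /= invg1 !mul1g.
Qed.

Lemma translateM s t D :
  tr s (tr t D) = tr (t.1 * s.1, s.2 * t.2)%g D.
Proof.
by apply/val_inj/funext => -[h g]; rewrite !translateE /= invgM !mulgA.
Qed.

(** [D0] gives nonemptiness. Sublevel sets of evaluation at (1, 1) are compact, which yields local
    compactness; control yields properness and totality yields cocompactness. *)
Lemma profile_coupling (D0 : X) : is_topological_coupling
  (fun g => tr (1%g, g)) (fun D h => tr (h, 1%g) D).
Proof.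
have hX : hausdorff_space X by exact: hausdorff_set_type.
have cl : continuous (fun p : G * X => tr (1%g, p.1) p.2).
  apply: translate_continuous => p;
    by [exact: cvg_cst|exact: cvg_fst|exact: cvg_snd].
have cr : continuous (fun p : H * X => tr (p.1, 1%g) p.2).
  apply: translate_continuous => p;
    by [exact: cvg_fst|exact: cvg_cst|exact: cvg_snd].
split => //.
- by exists D0.
- move=> D _; pose C := [set E : X | \val E (1, 1)%g <= \val D (1, 1)%g + 1].
  have cC : compact C by exact: compact_profiles.
  exists C; last by split => //; exact: compact_closed.
  have := nbhs_eval_lt D (1, 1)%g (@ltr01 R).
  apply: (@filterS _ (nbhs D)) => E + _.
  by rewrite /= ltr_norml /C /= => /andP[]; lra.
- by split=> [D|g g' D]; [exact: translate1|rewrite translateM mulg1].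
- by split=> [D|h h' D]; [exact: translate1|rewrite translateM mulg1].
- by move=> g D h; rewrite !translateM /= !(mulg1, mul1g).
- apply: translate_continuous => p;
    by [exact: cvg_snd|exact: cvg_cst|exact: cvg_fst].
- move=> K cK; have [r rP] := left_return_bounded cK.
  by apply: compact_return_set rP => //; exact: (@admissible_proper _ _ _ admG).
- move=> K cK; have [r rP] := right_return_bounded cK.
  by apply: (compact_return_set (f := fun h => tr (h, 1%g))) rP => //;
    exact: (@admissible_proper _ _ _ admH).
- exists [set D : X | \val D (1, 1)%g <= c]; split.
  + exact: compact_profiles.
  + apply/seteqP; split=> // D _.
    (* Translating by [g^-1] moves a point (1, g) of value at most [c] to (1, 1). *)
    have [g gc] := profile_totalH (profileP D) 1%g.
    exists g => //; exists (tr (1%g, g^-1%g) D).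
      by rewrite /= invgK !mulg1.
    by rewrite translateM /= mulg1 mulgV translate1.
  + apply/seteqP; split=> // D _.
    have [h hc] := profile_totalG (profileP D) 1%g.
    exists (tr (h, 1%g) D).
      by rewrite /= invg1 !mulg1.
    by exists h^-1%g => //; rewrite translateM /= mulgV mulg1 translate1.
Qed.

End profile_coupling.

(** * The distance to the graph of a coarse equivalence *)

Section graph_profile.
Context {R : realType} {G H : topologicalGroupType}.
Variables (dG : G -> G -> R) (dH : H -> H -> R) (phi : H -> G).
Hypothesis mG : is_metric dG.
Hypothesis mH : is_metric dH.

Let dists (p : H * G) : set R :=
  [set dH p.1 y + dG p.2 (phi y) | y in [set: H]].

Definition graph_dist (p : H * G) : R := inf (dists p).

Let dists_inf p : has_inf (dists p).
Proof.
split; first by exists (dH p.1 1%g + dG p.2 (phi 1%g)), 1%g.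
by exists 0 => _ [y _ <-]; rewrite addr_ge0// metric_ge0.
Qed.

Lemma graph_dist_le p y : graph_dist p <= dH p.1 y + dG p.2 (phi y).
Proof. by apply: ge_inf; [exact: (dists_inf p).2|exists y]. Qed.

Lemma graph_dist_lt p a : graph_dist p < a ->
  exists y, dH p.1 y + dG p.2 (phi y) < a.
Proof. by move=> /(inf_lt (dists_inf p).1)[_ [y _ <-]]; exists y. Qed.

(** Points of value below [a] are within [a] of graph points, so passing to the graph turns [t] into
    [t + 2 * a], and coming back from it adds [2 * a] again. The maximum lets one function serve
    both coordinates. *)
Lemma graph_dist_profile (c : R) (w1 w2 : R -> R) :
  0 <= c -> (forall g, exists h, dG g (phi h) <= c) ->
  (forall r x z, dH x z <= r -> dG (phi x) (phi z) <= w1 r) ->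
  (forall r x z, dG (phi x) (phi z) <= r -> dH x z <= w2 r) ->
  is_profile dG dH c
    (fun a t => Num.max (w1 (t + 2 * a)) (w2 (t + 2 * a)) + 2 * a) graph_dist.
Proof.
move=> c0 phic w1P w2P; split.
- move=> p; apply: lb_le_inf; first exact: (dists_inf p).1.
  by move=> _ [y _ <-]; rewrite addr_ge0// metric_ge0.
- move=> p q; rewrite -lerBlDr; apply: lb_le_inf; first exact: (dists_inf q).1.
  move=> _ [y _ <-]; have := graph_dist_le p y.
  have := is_metric_triangle mH p.1 q.1 y.
  have := is_metric_triangle mG p.2 q.2 (phi y).
  by lra.
- move=> h; exists (phi h); apply: le_trans (graph_dist_le (h, phi h) h) _.
  by rewrite (is_metric_refl mG) (is_metric_refl mH) addr0.
- move=> g; have [h hc] := phic g; exists h.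
  apply: le_trans (graph_dist_le (h, g) h) _.
  by rewrite (is_metric_refl mH) add0r.
- move=> a t p q /graph_dist_lt[x px] /graph_dist_lt[y qy] pqt.
  have := metric_ge0 mH p.1 x; have := metric_ge0 mG p.2 (phi x).
  have := metric_ge0 mH q.1 y; have := metric_ge0 mG q.2 (phi y) => *.
  have xy : dH x y <= t + 2 * a.
    have := is_metric_triangle mH x p.1 y.
    have := is_metric_triangle mH p.1 q.1 y.
    by rewrite (is_metric_sym mH x p.1); lra.
  have := is_metric_triangle mG p.2 (phi x) q.2.
  have := is_metric_triangle mG (phi x) (phi y) q.2.
  rewrite (is_metric_sym mG (phi y) q.2); have := w1P _ _ _ xy.
  have : w1 (t + 2 * a) <= Num.max (w1 (t + 2 * a)) (w2 (t + 2 * a)).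
    by rewrite le_max lexx.
  by lra.
- move=> a t p q /graph_dist_lt[x px] /graph_dist_lt[y qy] pqt.
  have := metric_ge0 mH p.1 x; have := metric_ge0 mG p.2 (phi x).
  have := metric_ge0 mH q.1 y; have := metric_ge0 mG q.2 (phi y) => *.
  have xy : dG (phi x) (phi y) <= t + 2 * a.
    have := is_metric_triangle mG (phi x) p.2 (phi y).
    have := is_metric_triangle mG p.2 q.2 (phi y).
    by rewrite (is_metric_sym mG (phi x) p.2); lra.
  have := is_metric_triangle mH p.1 x q.1.
  have := is_metric_triangle mH x y q.1.
  rewrite (is_metric_sym mH y q.1); have := w2P _ _ _ xy.
  have : w2 (t + 2 * a) <= Num.max (w1 (t + 2 * a)) (w2 (t + 2 * a)).
    by rewrite le_max lexx orbT.
  by lra.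
Qed.

End graph_profile.

(** * From a coarse equivalence to a coupling, and the equivalence *)

Lemma coarsely_equivalent_coupling (R : realType) (G H : topologicalGroupType) :
  coarsely_equivalent R G H -> admit_topological_coupling G H.
Proof.
move=> [dG [dH [admG admH [phi /coarse_equivalenceP[[c phic]]]]]].
move=> /choice[w1 w1P] /choice[w2 w2P].
have c0 : 0 <= c.
  have [h] := phic 1%g; apply: le_trans.
  exact: metric_ge0 (admissible_is_metric admG) _ _.
have prof := graph_dist_profile (admissible_is_metric admG)
  (admissible_is_metric admH) c0 phic w1P w2P.
by eexists _, _, _; exact: profile_coupling admG admH
  (exist _ (graph_dist dG dH phi : {ptws (H * G)%type -> R}) (mem_set prof)).
Qed.

Theorem theorem1 (R : realType) (G H : topologicalGroupType)
  (hausdorffG : hausdorff_space G) (hausdorffH : hausdorff_space H)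
  (lcG : locally_compact [set: G]) (lcH : locally_compact [set: H])
  (scG : @second_countable G) (scH : @second_countable H) :
  coarsely_equivalent R G H <-> admit_topological_coupling G H.
Proof.
split=> [|coupling]; first exact: coarsely_equivalent_coupling.
have [dG admG] := exists_admissible_metric R hausdorffG lcG scG.
have [dH admH] := exists_admissible_metric R hausdorffH lcH scH.
by exists dG, dH; split => //; exact: coupling_coarsely_equivalent.
Qed.
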